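(* Let $\{X_1,X_2,\dots\}$ be a $(d-1)$st order state aggregatable Markov process on $\{1,\dots,p\}$ with parameters $(r_1,\dots,r_{d-1})$, and let $\boldsymbol{\mathcal P}\in\mathbb{R}^{p\times\cdots\times p}$ (order $d$) be its transition tensor. Then $\boldsymbol{\mathcal P}$ has TT-rank no more than $(r_1,\dots,r_{d-1})$; in other words, $\mathrm{rank}([\boldsymbol{\mathcal P}]_k)\le r_k$ for all $1\le k\le d-1$.
   Context: Consider an ergodic, time-invariant, $(d-1)$st order Markov process on the finite state space $[p]=\{1,\dots,p\}$, with transition tensor $\boldsymbol{\mathcal P}$: $\mathbb{P}(X_{t+d}\mid X_1,\dots,X_{t+d-1})=\mathbb{P}(X_{t+d}\mid X_{t+1},\dots,X_{t+d-1})=\boldsymbol{\mathcal P}_{[X_{t+1},\dots,X_{t+d}]}$. The process is $(d-1)$st order state aggregatable (with parameters $r_1,\dots,r_{d-1}$) if there exist maps $G_1:[p]\to\mathbb{R}^{r_1}$, $G_k:[p]\times\mathbb{R}^{r_{k-1}}\to\mathbb{R}^{r_k}$ ($2\le k\le d-1$), $G_d:[p]\times\mathbb{R}^{r_{d-1}}\to\mathbb{R}$, where $G_2,\dots,G_d$ are linear in the second argument, i.e. $G_k(X,\lambda_1u+\lambda_2v)=\lambda_1G_k(X,u)+\lambda_2G_k(X,v)$ for all vectors $u,v$ and scalars $\lambda_1,\lambda_2$, such that for all $t\ge0$ the transition is generated sequentially by $\widetilde P_1(X_{t+1})=G_1(X_{t+1})\in\mathbb{R}^{r_1}$; $\widetilde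 P_k(X_{t+1},\dots,X_{t+k})=G_k\bigl(X_{t+k},\widetilde P_{k-1}(X_{t+1},\dots,X_{t+k-1})\bigr)\in\mathbb{R}^{r_k}$ for $k=2,\dots,d-1$; and $\mathbb{P}(X_{t+d}\mid X_1,\dots,X_{t+d-1})=\mathbb{P}(X_{t+d}\mid X_{t+1},\dots,X_{t+d-1})=G_d\bigl(X_{t+d},\widetilde P_{d-1}(X_{t+1},\dots,X_{t+d-1})\bigr)$. Thus $\boldsymbol{\mathcal P}_{i_1,\dots,i_d}=G_d(i_d,\widetilde P_{d-1}(i_1,\dots,i_{d-1}))$ for all $i_1,\dots,i_d\in[p]$. The sequential unfolding $[\boldsymbol{\mathcal P}]_k\in\mathbb{R}^{p^k\times p^{d-k}}$ is the matrix whose rows enumerate the indices of modes $1,\dots,k$ and whose columns enumerate the indices of modes $k+1,\dots,d$. The TT-rank of a tensor is the tuple of ranks of its sequential unfoldings, $(\mathrm{rank}([\boldsymbol{\mathcal P}]_1),\dots,\mathrm{rank}([\boldsymbol{\mathcal P}]_{d-1}))$, equivalently the smallest ranks $(r_1,\dots,r_{d-1})$ allowing a decomposition $\boldsymbol{\mathcal P}_{i_1,\dots,i_d}=\sum_{\alpha_1=1}^{r_1}\cdots\sum_{\alpha_{d-1}=1}^{r_{d-1}}G_{1,[i_1,\alpha_1]}\boldsymbol{\mathcal G}_{2,[\alpha_1,i_2,\alpha_2]}\cdots\boldsymbol{\mathcal G}_{d-1,[\alpha_{d-2},i_{d-1},\alpha_{d-1}]}G_{d,[i_d,\alpha_{d-1}]}$.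 *)

(* Defs.v *)
From HB Require Import structures.
From mathcomp Require Import all_boot all_order all_algebra.
From mathcomp Require Import all_classical all_reals all_analysis.

Set Implicit Arguments.
Unset Strict Implicit.
Unset Printing Implicit Defensive.

Import Order.TTheory GRing.Theory Num.Theory.
Local Open Scope classical_set_scope.
Local Open Scope ring_scope.

(* Conventions.  The order of the Markov process is m = d - 1, so that its
   transition tensor has order d = m.+1.  States are elements of 'I_p and time
   starts at 0: X t and x t stand for X_{t+1} and i_{t+1}.  The parameters keep
   their mathematical numbering: r k is r_k for 1 <= k <= m, and the other
   values of r : nat -> nat are irrelevant. *)

Section Tensor.
Variables (R : realType) (p m : nat).

Definition tensor := m.+1.-tuple 'I_p -> R.

(* Rows are indexed by the values of modes 1..k and columns by those of modes
   k+1..d; #|{: n.-tuple 'I_p}| = p ^ n by card_tuple and card_ord. *)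
Definition unfolding (Q : tensor) (k : 'I_m.+1) :
    'M[R]_(#|{: k.-tuple 'I_p}|, #|{: (m.+1 - k).-tuple 'I_p}|) :=
  \matrix_(a, b)
    let u : k.-tuple 'I_p := enum_val a in
    let v : (m.+1 - k).-tuple 'I_p := enum_val b in
    Q (tcast (subnKC (ltnW (ltn_ord k))) [tuple of u ++ v]).

(* Only the entries 1 <= k <= m = d - 1 belong to the TT-rank. *)
Definition tt_rank (Q : tensor) (k : 'I_m.+1) : nat := \rank (unfolding Q k).

Definition stochastic_tensor (Q : tensor) : Prop :=
  (forall i, 0 <= Q i) /\
  (forall u : m.-tuple 'I_p, \sum_(a : 'I_p) Q [tuple of rcons u a] = 1).

(* n-step transition probabilities of the chain of blocks of m consecutive
   states, which moves from (i_1, ..., i_m) to (i_2, ..., i_m, a) with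
   probability Q (i_1, ..., i_m, a). *)
Fixpoint nstep (Q : tensor) (n : nat) (u v : m.-tuple 'I_p) : R :=
  if n is n'.+1 then
    \sum_(a : 'I_p) Q [tuple of rcons u a]
                    * nstep Q n' [tuple of behead (rcons u a)] v
  else (u == v)%:R.

Definition irreducible_tensor (Q : tensor) : Prop :=
  forall u v, exists n, 0 < nstep Q n u v.

(* The greatest common divisor of the return times of every block is 1. *)
Definition aperiodic_tensor (Q : tensor) : Prop :=
  forall u (e : nat),
    (forall n, (0 < n)%N -> 0 < nstep Q n u u -> (e %| n)%N) -> e = 1%N.

Definition ergodic_tensor (Q : tensor) : Prop :=
  irreducible_tensor Q /\ aperiodic_tensor Q.

End Tensor.

Section Process.
Variables (R : realType) (dT : measure_display) (T : measurableType dT).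
Variables (mu : probability T R) (p : nat) (X : nat -> T -> 'I_p).

Definition measurable_process : Prop :=
  forall t (a : 'I_p), measurable (X t @^-1` [set a]).

Definition cprob (A B : set T) : R := fine (mu (A `&` B)) / fine (mu B).

(* The event that X follows the trajectory x at the times s, ..., s + n - 1. *)
Definition path_event (x : nat -> 'I_p) (s n : nat) : set T :=
  [set w | forall j, (j < n)%N -> X (s + j)%N w = x (s + j)%N].

(* P(X_{t+d} | X_1, ..., X_{t+d-1}) = P(X_{t+d} | X_{t+1}, ..., X_{t+d-1}) = K
   for all t >= 0.  K sees the trajectory from time t on; the instances below
   only read its values at 0, ..., m.  Elementary conditional probabilities
   are meaningful only for histories of positive probability. *)
Definition has_transition_law (m : nat) (K : (nat -> 'I_p) -> R) : Prop :=
  forall t (x : nat -> 'I_p), mu (path_event x 0 (t + m)) != 0%E ->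
    let next := [set w | X (t + m)%N w = x (t + m)%N] in
    cprob next (path_event x 0 (t + m)) = cprob next (path_event x t m) /\
    cprob next (path_event x t m) = K (fun s => x (t + s)%N).

Definition ergodic_markov_process (m : nat) (Q : tensor R p m) : Prop :=
  [/\ measurable_process,
      stochastic_tensor Q,
      has_transition_law m (fun x => Q [tuple x j | j < m.+1])
    & ergodic_tensor Q].

Section Aggregation.
Variable r : nat -> nat.
Variable G1 : 'I_p -> 'rV[R]_(r 1%N).
Variable G : forall k, 'I_p -> 'rV[R]_(r k.-1) -> 'rV[R]_(r k).

(* aggregate x k is \tilde P_k (x 0, ..., x k.-1); its value at k = 0 is
   a dummy. *)
Fixpoint aggregate (x : nat -> 'I_p) (k : nat) : 'rV[R]_(r k) :=
  match k return 'rV[R]_(r k) with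
  | 0 => 0
  | k'.+1 =>
      match k' return 'rV[R]_(r k') -> 'rV[R]_(r k'.+1) with
      | 0 => fun=> G1 (x 0%N)
      | k''.+1 => @G k''.+2 (x k''.+1)
      end (aggregate x k')
  end.

End Aggregation.

Definition state_aggregatable (m : nat) (r : nat -> nat) : Prop :=
  exists (G1 : 'I_p -> 'rV[R]_(r 1%N))
         (G : forall k, 'I_p -> 'rV[R]_(r k.-1) -> 'rV[R]_(r k))
         (Gd : 'I_p -> 'rV[R]_(r m) -> R),
    [/\ forall k a, (2 <= k <= m)%N -> linear (@G k a),
        forall a, scalar (Gd a)
      & has_transition_law m (fun x => Gd (x m) (aggregate G1 G x m))].

End Process.

(* Main.v *)
Require Import Defs.
From mathcomp Require Import all_boot all_order all_algebra.
From mathcomp Require Import all_classical all_reals all_analysis.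
From HB Require Import structures.

(** The rank bound comes from a factorization of the unfolding through
    R^(r k): once modes k+1, ..., d are fixed, all the aggregation maps that
    follow step k are linear, so the transition probability is a linear
    functional, depending on modes k+1, ..., d only, of the aggregated vector
    P~_k of modes 1, ..., k ([tail_functional]).  Hence the k-th unfolding is a
    product of a matrix with r k columns and a matrix with r k rows.

    The aggregation hypothesis speaks of conditional probabilities of the
    process, hence only of histories of positive probability, and one has to
    show that it determines every entry of the transition tensor
    ([transition_laws_agree]).  Some initial block of m states has positive
    probability, since finitely many blocks cover the sample space
    ([initial_block]).  By irreducibility a chain of transitions of positive
    probability leads from it to any prescribed block, and such transitions
    prolong histories of positive probability to histories of positive
    probability ([reachable_block]).  So each block ends some history of
    positive probability, where both descriptions of the transition law
    apply. *)

Set Implicit Arguments.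
Unset Strict Implicit.
Unset Printing Implicit Defensive.

Import Order.TTheory GRing.Theory Num.Theory.
Local Open Scope classical_set_scope.
Local Open Scope ring_scope.

(** * Blocks of consecutive states as tuples *)

Section Blocks.
Variable S : Type.

Lemma val_mktuple_nat (f : nat -> S) n :
  [tuple f j | j < n] = mkseq f n :> seq S.
Proof. by rewrite /= /mkseq -val_enum_ord -map_comp. Qed.

Lemma eq_mktuple_nat n (f g : nat -> S) :
  (forall j, (j < n)%N -> f j = g j) ->
  [tuple f j | j < n] = [tuple g j | j < n].
Proof. by move=> fg; apply: eq_mktuple => j; apply: fg. Qed.

Lemma rcons_block (x : nat -> S) s n :
  [tuple of rcons [tuple x (s + j)%N | j < n] (x (s + n)%N)] =
  [tuple x (s + j)%N | j < n.+1].
Proof.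
apply: val_inj; rewrite /= (val_mktuple_nat (fun j => x (s + j)%N) n).
by rewrite (val_mktuple_nat (fun j => x (s + j)%N) n.+1) mkseqS.
Qed.

Lemma behead_block (x : nat -> S) s n :
  [tuple of behead [tuple x (s + j)%N | j < n.+1]] =
  [tuple x (s.+1 + j)%N | j < n].
Proof.
apply: val_inj; rewrite [RHS](val_mktuple_nat (fun j => x (s.+1 + j)%N) n).
transitivity (behead (mkseq (fun j => x (s + j)%N) n.+1)).
  by rewrite -val_mktuple_nat.
rewrite /mkseq /=.
rewrite (iotaDl 1 0) -map_comp; apply: eq_map => j /=.
by rewrite addnA addn1.
Qed.

Lemma mktuple_nth (a0 : S) n (u : n.-tuple S) :
  [tuple nth a0 u j | j < n] = u.
Proof.
apply: val_inj; rewrite [LHS](val_mktuple_nat (nth a0 u)).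
by rewrite -{2}(size_tuple u) mkseq_nth.
Qed.

End Blocks.

(** * Histories of positive probability *)

Section Histories.
Variables (R : realType) (dT : measure_display) (T : measurableType dT).
Variables (mu : probability T R) (p : nat) (X : nat -> T -> 'I_p).
Hypothesis mX : measurable_process X.

Lemma path_eventS x s n :
  path_event X x s n.+1 =
  [set w | X (s + n)%N w = x (s + n)%N] `&` path_event X x s n.
Proof.
apply/seteqP; split=> w /=.
  by move=> H; split=> [|j jn]; apply: H => //; apply: ltnW.
move=> [Hn H] j; rewrite ltnS leq_eqVlt => /predU1P[-> //|]; exact: H.
Qed.

Lemma eq_path_event x y s n :
  (forall j, (j < n)%N -> x (s + j)%N = y (s + j)%N) ->
  path_event X x s n = path_event X y s n.
Proof.
by move=> xy; apply/seteqP; split=> w H j jn; rewrite (H j jn) xy.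
Qed.

Lemma measurable_path_event x s n : measurable (path_event X x s n).
Proof.
elim: n => [|n IHn].
  by rewrite (_ : path_event _ _ _ _ = setT)//; apply/seteqP; split.
rewrite path_eventS; apply: measurableI => //; exact: (mX (s + n) (x (s + n)%N)).
Qed.

Lemma sample_point : exists w : T, True.
Proof.
have [[w _]|/forallNP noT] := pselect (exists w : T, True); first by exists w.
have T0 : [set: T] = set0 by apply/seteqP; split=> w // _; case: (noT w).
by have := probability_setT mu; rewrite T0 measure0 => /eqP; rewrite eq_sym onee_eq0.
Qed.

(** The blocks of length n cover the sample space, so they cannot all be
    null. *)
Lemma initial_block n : exists x, mu (path_event X x 0 n) != 0%E.
Proof.
have [w0 _] := sample_point; pose a0 := X 0%N w0.
apply/not_existsP => null.
(* The finitely many blocks, listed as a sequence of trajectories, since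
   countable unions of negligible sets are negligible. *)
pose x i := nth a0 (nth (nseq_tuple n a0) (enum {: n.-tuple 'I_p}) i).
have negl : mu.-negligible (\bigcup_i path_event X (x i) 0 n).
  apply: negligible_bigcup => i.
  apply/negligibleP; first exact: measurable_path_event.
  by apply/eqP/negPn/negP/null.
have cover : \bigcup_i path_event X (x i) 0 n = setT.
  apply/seteqP; split=> // w _.
  pose u := [tuple X j w | j < n].
  exists (index u (enum {: n.-tuple 'I_p})) => // j jn.
  rewrite /x nth_index ?mem_enum // add0n.
  by rewrite (val_mktuple_nat (X^~ w)) nth_mkseq.
have /eqP : mu setT = 0%E by rewrite cover in negl; apply/negligibleP.
by rewrite probability_setT onee_eq0.
Qed.

Lemma cprob_neq0 (A B : set T) : cprob mu A B != 0 -> mu (A `&` B) != 0%E.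
Proof. by apply: contra_neq => AB0; rewrite /cprob AB0 mul0r. Qed.

Variables (m : nat) (Q : tensor R p m).
Hypothesis Q_ge0 : forall i, 0 <= Q i.
Hypothesis law : has_transition_law mu X m (fun x => Q [tuple x j | j < m.+1]).

Lemma nstep_ge0 n u v : 0 <= nstep Q n u v.
Proof.
elim: n u => [|n IHn] u /=; first exact: ler0n.
by apply: sumr_ge0 => a _; apply: mulr_ge0.
Qed.

(** A transition probability is a conditional probability, so a history
    followed by a transition of positive probability has positive
    probability itself. *)
Lemma extend_history x s :
  mu (path_event X x 0 (s + m)) != 0%E ->
  0 < Q [tuple x (s + j)%N | j < m.+1] ->
  mu (path_event X x 0 (s.+1 + m)) != 0%E.
Proof.
move=> hist Qpos; rewrite addSn path_eventS add0n.
have [e1 e2] := law hist.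
by apply: cprob_neq0; rewrite e1 e2 gt_eqF.
Qed.

(** The positivity of an n-step probability provides a chain of n transitions
    of positive probability, all terms of the sum being nonnegative; the chain
    prolongs the given history one state at a time. *)
Lemma reachable_block n x s v :
  mu (path_event X x 0 (s + m)) != 0%E ->
  0 < nstep Q n [tuple x (s + j)%N | j < m] v ->
  exists y t, mu (path_event X y 0 (t + m)) != 0%E /\
              [tuple y (t + j)%N | j < m] = v.
Proof.
elim: n x s => [|n IHn] x s hist /=.
  case: eqP => [<- _|_]; last by rewrite ltxx.
  by exists x, s.
move=> step_pos.
have [a a_pos] : exists a, 0 < Q [tuple of rcons [tuple x (s + j)%N | j < m] a] *
    nstep Q n [tuple of behead (rcons [tuple x (s + j)%N | j < m] a)] v.
  apply/not_existsP => none; move: step_pos; rewrite big1 ?ltxx // => a _.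
  apply/eqP; rewrite eq_le mulr_ge0 ?nstep_ge0 // andbT leNgt.
  exact/negP/none.
(* The history continued by the state a. *)
pose y j := if j == (s + m)%N then a else x j.
have yx j : (j < s + m)%N -> y j = x j by rewrite /y; case: ltngtP.
have blockE : [tuple x (s + j)%N | j < m] = [tuple y (s + j)%N | j < m].
  apply: (@eq_mktuple_nat _ _ (fun j => x (s + j)%N) (fun j => y (s + j)%N)) => j jm.
  by rewrite yx // ltn_add2l.
have aE : a = y (s + m)%N by rewrite /y eqxx.
have histE : path_event X x 0 (s + m) = path_event X y 0 (s + m).
  by apply: eq_path_event => j jm; rewrite add0n yx.
rewrite histE in hist.
have nextE : [tuple of behead (rcons [tuple x (s + j)%N | j < m] a)] =
    [tuple y (s.+1 + j)%N | j < m].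
  by rewrite -behead_block -rcons_block -blockE -aE; apply: val_inj.
have transE : [tuple of rcons [tuple x (s + j)%N | j < m] a] =
    [tuple y (s + j)%N | j < m.+1].
  by rewrite -rcons_block -blockE -aE.
move: a_pos; rewrite nextE transE => prod_pos.
have Q_pos : 0 < Q [tuple y (s + j)%N | j < m.+1].
  rewrite lt_neqAle Q_ge0 andbT eq_sym.
  by apply: contraTneq prod_pos => ->; rewrite mul0r ltxx.
apply: (IHn y s.+1); first exact: extend_history.
by rewrite -(pmulr_rgt0 _ Q_pos).
Qed.

(** Irreducibility lets every block of m states end some history of positive
    probability; there the conditional probability of the next state equals
    the value of any kernel that describes the transition law.  The kernel K
    reads a whole trajectory, whence its locality hypothesis. *)
Lemma transition_laws_agree (K : (nat -> 'I_p) -> R) :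
  (forall x y, (forall j, (j <= m)%N -> x j = y j) -> K x = K y) ->
  irreducible_tensor Q -> has_transition_law mu X m K ->
  forall x : nat -> 'I_p, Q [tuple x j | j < m.+1] = K x.
Proof.
move=> K_local irr lawK x.
have [x0 hist0] := initial_block m.
have [n n_pos] := irr [tuple x0 j | j < m] [tuple x j | j < m].
have [y [t [hist yE]]] := reachable_block (s := 0%N) hist0 n_pos.
(* The history reaching the block, with the prescribed next state. *)
pose z j := if j == (t + m)%N then x m else y j.
have zx j : (j <= m)%N -> z (t + j)%N = x j.
  rewrite /z eqn_add2l leq_eqVlt; case: eqP => [-> //|_ /= jm].
  by have /(congr1 (fun u => tnth u (Ordinal jm))) := yE; rewrite !tnth_mktuple.
have histz : mu (path_event X z 0 (t + m)) != 0%E.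
  rewrite (_ : path_event X z 0 (t + m) = path_event X y 0 (t + m)) //.
  by apply: eq_path_event => j jm; rewrite add0n /z ltn_eqF.
have [_ eQ] := law histz; have [_ eK] := lawK _ _ histz.
rewrite -(K_local _ _ zx) -eK eQ; congr Q; apply/esym.
by apply: (@eq_mktuple_nat _ _ (fun j => z (t + j)%N) x) => j; apply: zx.
Qed.

End Histories.

(** * Factorization of the unfoldings *)

Lemma scalar_mulmxE (R : realType) n (f : 'rV[R]_n -> R) :
  scalar f -> forall v, f v = (v *m \col_i f (delta_mx 0 i)) 0 0.
Proof.
move=> f_lin v.
pose fL : {scalar 'rV[R]_n} := HB.pack f (GRing.isLinear.Build R 'rV[R]_n R _ f f_lin).
rewrite -[f]/(fL : _ -> _) [in LHS](row_sum_delta v) linear_sum mxE.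
by apply: eq_bigr => i _; rewrite linearZ mxE.
Qed.

Section Aggregation.
Variables (R : realType) (p m : nat) (r : nat -> nat).
Variable G1 : 'I_p -> 'rV[R]_(r 1%N).
Variable G : forall k, 'I_p -> 'rV[R]_(r k.-1) -> 'rV[R]_(r k).
Variable Gd : 'I_p -> 'rV[R]_(r m) -> R.
Arguments G : clear implicits.

Lemma eq_aggregate x y k :
  (forall j, (j < k)%N -> x j = y j) ->
  aggregate G1 G x k = aggregate G1 G y k.
Proof.
elim: k => [//|[|k] IHk] xy; first by rewrite /= xy.
rewrite -[LHS]/(G k.+2 (x k.+1) (aggregate G1 G x k.+1)).
by rewrite IHk => [|j jk]; rewrite ?xy // ltnW.
Qed.

Hypothesis G_lin : forall k a, (2 <= k <= m)%N -> linear (G k a).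
Hypothesis Gd_lin : forall a, scalar (Gd a).

(** The functional is built backwards from the last map Gd, by composing with
    one linear aggregation map at a time.  It stops at k = 1 because G1 takes
    no vector argument. *)
Lemma tail_functional n k (y : nat -> 'I_p) :
  (0 < k)%N -> (k + n)%N = m ->
  exists c : 'cV[R]_(r k), forall x, (forall j, (k <= j)%N -> x j = y j) ->
    Gd (x m) (aggregate G1 G x m) = (aggregate G1 G x k *m c) 0 0.
Proof.
elim: n k => [|n IHn] k k_gt0 knm.
  rewrite addn0 in knm; subst k.
  exists (\col_i Gd (y m) (delta_mx 0 i)) => x xy.
  by rewrite xy // -scalar_mulmxE.
have [|c cE] := IHn k.+1 isT; first by rewrite addSnnS.
case: k k_gt0 knm c cE => // k _ knm c cE.
pose f v := (G k.+2 (y k.+1) v *m c) 0 0.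
have f_lin : scalar f.
  move=> a u v; rewrite /f G_lin; last by rewrite /= -knm addnS ltnS leq_addr.
  by rewrite mulmxDl -scalemxAl !mxE.
exists (\col_i f (delta_mx 0 i)) => x xy.
rewrite cE => [|j jk]; last by rewrite xy // ltnW.
by rewrite -scalar_mulmxE // /f -xy.
Qed.

(** The rows of the left factor are the aggregated vectors of modes 1..k, the
    columns of the right factor the functionals given by modes k+1..d.  The
    state a0 serves only to extend tuples to infinite trajectories. *)
Lemma tt_rank_aggregate (Q : tensor R p m) (k : 'I_m.+1) :
  'I_p -> (0 < k)%N ->
  (forall x : nat -> 'I_p, Q [tuple x j | j < m.+1] = Gd (x m) (aggregate G1 G x m)) ->
  (tt_rank Q k <= r k)%N.
Proof.
move=> a0 k_gt0 QE.
have km : (k + (m - k) = m)%N by rewrite subnKC // -ltnS.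
have /choice[c cE] := fun v : (m.+1 - k).-tuple 'I_p =>
  tail_functional (fun j => nth a0 v (j - k)) k_gt0 km.
pose A : 'M[R]_(#|{: k.-tuple 'I_p}|, r k) :=
  \matrix_(a < #|{: k.-tuple 'I_p}|) aggregate G1 G (nth a0 (enum_val a)) k.
pose B : 'M[R]_(r k, #|{: (m.+1 - k).-tuple 'I_p}|) :=
  \matrix_(i, b) c (enum_val b) i 0.
rewrite /tt_rank (_ : unfolding Q k = A *m B) ?mulmx_max_rank//.
apply/matrixP => a b; rewrite [LHS]mxE /=.
set u := enum_val a; set v := enum_val b.
rewrite -(mktuple_nth a0 (tcast _ _)) QE val_tcast /=.
rewrite (cE v) => [|j kj]; last by rewrite nth_cat size_tuple ltnNge kj.
rewrite (@eq_aggregate _ (nth a0 u)) => [|j jk]; last first.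
  by rewrite nth_cat size_tuple jk.
by rewrite !mxE; apply: eq_bigr => i _; rewrite !mxE.
Qed.

End Aggregation.

Theorem proposition5p1 (R : realType) (dT : measure_display)
    (T : measurableType dT) (mu : probability T R) (p m : nat)
    (X : nat -> T -> 'I_p) (Q : tensor R p m) (r : nat -> nat) :
  (0 < m)%N ->
  ergodic_markov_process mu X Q ->
  state_aggregatable mu X m r ->
  forall k : 'I_m.+1, (0 < k)%N -> (tt_rank Q k <= r k)%N.
Proof.
move=> _ [mX [Q_ge0 _] lawQ [irr _]] [G1 [G [Gd [G_lin Gd_lin lawG]]]] k k_gt0.
have [w _] := sample_point mu.
apply: (tt_rank_aggregate G_lin Gd_lin (X 0%N w) k_gt0).
apply: (transition_laws_agree mX Q_ge0 lawQ _ irr lawG) => x y xy.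
rewrite xy // (eq_aggregate G1 G (y := y)) // => j jm.
by rewrite xy // ltnW.
Qed.
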